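(* For every integer $M\ge 4$, the halved cube $\Delta_M$ is a deletion host for $T_M$; that is, $E(\Delta_M)\neq\varnothing$, $\Delta_M$ contains no induced subgraph isomorphic to $T_M$, and for every edge $e$ of $\Delta_M$ the graph $\Delta_M-e$ contains an induced subgraph isomorphic to $T_M$.
   Context: The halved cube $\Delta_n$ is the graph whose vertices are the even-cardinality subsets of $[n]=\{1,\dots,n\}$, with $X,Y$ adjacent if and only if $|X\mathbin{\triangle}Y|=2$ (symmetric difference). $T_M$ is the graph formed from a clique of order $M$ by adding one vertex with exactly two neighbors in the clique. $\Delta_M-e$ denotes deletion of the edge $e$, keeping all vertices. *)

(* Defs.v *)
From mathcomp Require Import all_boot.
Set Implicit Arguments.
Unset Strict Implicit.
Unset Printing Implicit Defensive.

Record sgraph := SGraph {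
  vertex :> finType;
  adj : rel vertex;
  adj_sym : symmetric adj;
  adj_irrefl : irreflexive adj
}.

Definition edges (G : sgraph) : {set {set G}} :=
  [set [set x; y] | x in G, y in G & adj x y].

Section Induced.
Variables (G : sgraph) (S : {set G}).

Definition induced_adj : rel {x : G | x \in S} := fun u v => adj (val u) (val v).

Lemma induced_sym : symmetric induced_adj.
Proof. by move=> u v; exact: adj_sym. Qed.

Lemma induced_irrefl : irreflexive induced_adj.
Proof. by move=> u; exact: adj_irrefl. Qed.

Definition induced : sgraph := SGraph induced_sym induced_irrefl.
End Induced.

Definition isomorphic (G H : sgraph) : Prop :=
  exists f : G -> H, bijective f /\ {mono f : x y / adj x y}.

Definition contains_induced (G H : sgraph) : Prop :=
  exists S : {set G}, isomorphic (induced S) H.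

Section DeleteEdge.
Variables (G : sgraph) (e : {set G}).

Definition del_edge_adj : rel G := fun x y => adj x y && ([set x; y] != e).

Lemma del_edge_sym : symmetric del_edge_adj.
Proof. by move=> x y; rewrite /del_edge_adj adj_sym setUC. Qed.

Lemma del_edge_irrefl : irreflexive del_edge_adj.
Proof. by move=> x; rewrite /del_edge_adj adj_irrefl. Qed.

Definition del_edge : sgraph := SGraph del_edge_sym del_edge_irrefl.
End DeleteEdge.

Definition deletion_host (G H : sgraph) : Prop :=
  [/\ edges G != set0,
      ~ contains_induced G H &
      forall e : {set G}, e \in edges G -> contains_induced (del_edge e) H].

Definition symdiff (T : finType) (A B : {set T}) : {set T} :=
  (A :\: B) :|: (B :\: A).

Section HalvedCube.
Variable n : nat.

Definition halved_cube_adj : rel {A : {set 'I_n} | ~~ odd #|A|} :=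
  fun X Y => #|symdiff (val X) (val Y)| == 2.

Lemma halved_cube_sym : symmetric halved_cube_adj.
Proof. by move=> X Y; rewrite /halved_cube_adj /symdiff setUC. Qed.

Lemma halved_cube_irrefl : irreflexive halved_cube_adj.
Proof. by move=> X; rewrite /halved_cube_adj /symdiff setDv setU0 cards0. Qed.

(* The ground set [n] is represented by 'I_n = {0, ..., n-1}. *)
Definition halved_cube : sgraph := SGraph halved_cube_sym halved_cube_irrefl.
End HalvedCube.

Section TGraph.
Variable M : nat.

(* The clique is [Some i] for i : 'I_M; the added vertex [None] is joined
   exactly to the clique vertices 0 and 1, so it has two neighbours only
   when 2 <= M. *)
Definition tgraph_adj : rel (option 'I_M) := fun u v =>
  match u, v with
  | Some i, Some j => i != j
  | Some i, None | None, Some i => i < 2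
  | None, None => false
  end.

Lemma tgraph_sym : symmetric tgraph_adj.
Proof. by move=> [i|] [j|] //=; rewrite eq_sym. Qed.

Lemma tgraph_irrefl : irreflexive tgraph_adj.
Proof. by move=> [i|] //=; rewrite eqxx. Qed.

Definition tgraph : sgraph := SGraph tgraph_sym tgraph_irrefl.
End TGraph.

(* Main.v *)
Require Import Defs.
From mathcomp Require Import all_boot.
From mathcomp Require Import perm zify.
Set Implicit Arguments.
Unset Strict Implicit.
Unset Printing Implicit Defensive.

(** Translating the added vertex of an induced [T_M] to the empty set, its two
    neighbours in the clique become pairs [{a,b}] and [{a,c}]; any other clique
    vertex is at distance 2 from both but is neither empty nor a pair, so it is
    [{a,b,c,d}] for some [d] outside [{a,b,c}]. That leaves room for [M - 3]
    further clique vertices only, while [M - 2] are needed. Conversely, given an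
    edge between [X] and [X + {a,b}], choose [c] outside [{a,b}]: in the clique
    of all sets at distance 1 from [X + {a,b,c}] (sums being symmetric
    differences), [X] has exactly the neighbours [X + {a,b}], [X + {a,c}] and
    [X + {b,c}], and loses the first one with the edge. *)

Section Symdiff.
Variable T : finType.
Implicit Types (A B C D : {set T}) (x y : T).

Lemma in_symdiff A B x : (x \in symdiff A B) = (x \in A) (+) (x \in B).
Proof. by rewrite !inE; case: (x \in A); case: (x \in B). Qed.

Lemma symdiffA : associative (@symdiff T).
Proof. by move=> A B C; apply/setP => x; rewrite !in_symdiff addbA. Qed.

Lemma symdiffK A B : symdiff A (symdiff A B) = B.
Proof. by apply/setP => x; rewrite !in_symdiff addKb. Qed.

Lemma symdiff_inj A : injective (symdiff A).
Proof. exact: can_inj (symdiffK A). Qed.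

Lemma symdiff_translate C A B :
  symdiff (symdiff C A) (symdiff C B) = symdiff A B.
Proof.
by apply/setP => x; rewrite !in_symdiff addbACA addbb.
Qed.

(** Stated additively, with the intersection counted twice, to avoid truncated subtraction and to
    make the parity rule immediate. *)
Lemma card_symdiff A B : #|symdiff A B| + #|A :&: B|.*2 = #|A| + #|B|.
Proof.
rewrite cardsU (_ : (A :\: B) :&: (B :\: A) = set0); last first.
  by apply/setP => x; rewrite !inE; case: (x \in A); rewrite ?andbF.
have := cardsID B A; have := cardsID A B; rewrite setIC cards0; lia.
Qed.

Lemma odd_symdiff A B : odd #|symdiff A B| = odd #|A| (+) odd #|B|.
Proof. by rewrite -oddD -card_symdiff oddD odd_double addbF. Qed.

Lemma card_symdiff1 A x :
  #|symdiff A [set x]| = if x \in A then #|A|.-1 else #|A|.+1.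
Proof.
have := card_symdiff A [set x]; rewrite cards1.
case: (boolP (x \in A)) => xA.
  by rewrite (setIidPr _) ?sub1set // cards1; lia.
rewrite (_ : A :&: [set x] = set0) ?cards0; first lia.
by apply/setP => y; rewrite !inE; case: eqP => [->|]; rewrite ?(negPf xA) ?andbF.
Qed.

(** By [card_symdiff], [#|D| = 2 * #|D :&: A|], which is 0, 2 or 4; only 4 is left, so [D] contains
    [A], and likewise [B]. As [A] and [B] share one point, their union has 3 elements and [D] one
    more. *)
Lemma quadruple_of_two_pairs A B D :
    #|A| = 2 -> #|B| = 2 -> #|symdiff A B| = 2 ->
    #|symdiff D A| = 2 -> #|symdiff D B| = 2 -> D != set0 -> #|D| != 2 ->
  exists2 d, d \notin A :|: B & D = d |: (A :|: B).
Proof.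
move=> cA cB cAB cDA cDB; rewrite -card_gt0 => D_gt0 D_neq2.
have eAB := card_symdiff A B; have eDA := card_symdiff D A.
have eDB := card_symdiff D B; have eU := cardsUI A B.
have leA := subset_leq_card (subsetIr D A).
have sAD : A \subset D.
  by apply/setIidPr/eqP; rewrite eqEcard subsetIr; lia.
have sBD : B \subset D.
  by apply/setIidPr/eqP; rewrite eqEcard subsetIr; lia.
have sUD : A :|: B \subset D by rewrite subUset sAD.
have /eqP/cards1P[d Dd] : #|D :\: (A :|: B)| = 1.
  by rewrite cardsDS //; lia.
exists d; first by have := set11 d; rewrite -Dd inE => /andP[].
by rewrite -Dd setUC -{1}(setID D (A :|: B)) (setIidPr sUD).
Qed.

Lemma set2_injr x : injective (fun y => [set x; y]).
Proof.
move=> y z /setP e; move: (e y) (e z); rewrite !inE !eqxx !orbT.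
move=> /esym/orP[/eqP->|/eqP//]; rewrite orbb.
by move=> /eqP->.
Qed.

(** The second transposition fixes [x']: the first one already sends [x] there, hence not [y], and
    [y'] differs from [x']. *)
Lemma perm_exists2 x y x' y' :
  x != y -> x' != y' -> exists s : {perm T}, s x = x' /\ s y = y'.
Proof.
move=> xy xy'; exists (tperm x x' * tperm (tperm x x' y) y')%g.
rewrite !permM tpermL; split; last by rewrite tpermL.
by rewrite tpermD 1?eq_sym // -{1}(tpermL x x') (inj_eq perm_inj).
Qed.
End Symdiff.

Lemma contains_induced_embedding (G H : sgraph) (f : H -> G) :
  injective f -> {mono f : x y / adj x y} -> contains_induced G H.
Proof.
move=> f_inj f_mono; exists [set f x | x in H].
pose S : {set G} := [set f x | x in H].
have fS x : f x \in S by apply: imset_f.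
pose h x : induced S := exist _ (f x) (fS x).
have h_inj : injective h by move=> x y [] /f_inj.
have h_bij : bijective h.
  apply: inj_card_bij => //.
  by rewrite card_sig -(card_imset _ f_inj) -/S; apply: subset_leq_card.
have [g hK gK] := h_bij; exists g; split; first by exists h.
by move=> u v; rewrite -{2}(gK u) -{2}(gK v) -f_mono.
Qed.

Lemma embedding_of_contains_induced (G H : sgraph) :
  contains_induced G H ->
  exists f : H -> G, injective f /\ {mono f : x y / adj x y}.
Proof.
move=> [S [g [[h gK hK] g_mono]]]; exists (fun x => val (h x)); split.
  by move=> x y /val_inj; apply: can_inj hK _ _.
by move=> x y; rewrite -{2}(hK x) -{2}(hK y) g_mono.
Qed.

Lemma halved_cube_adjE n (X Y : halved_cube n) :
  adj X Y = (#|symdiff (val X) (val Y)| == 2).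
Proof. by []. Qed.

Lemma halved_cube_edges_neq0 n : 1 < n -> edges (halved_cube n) != set0.
Proof.
move=> n_gt1; pose a : 'I_n := Ordinal (ltnW n_gt1); pose b := Ordinal n_gt1.
have ev0 : ~~ odd #|set0 : {set 'I_n}| by rewrite cards0.
have ev2 : ~~ odd #|[set a; b]| by rewrite cards2.
pose X : halved_cube n := exist _ set0 ev0.
pose Y : halved_cube n := exist _ [set a; b] ev2.
apply/set0Pn; exists [set X; Y]; apply/imset2P; exists X Y => //.
by rewrite inE halved_cube_adjE /symdiff set0D setD0 set0U cards2.
Qed.

Lemma halved_cube_tgraph_free M :
  1 < M -> ~ contains_induced (halved_cube M) (tgraph M).
Proof.
move=> M_gt1 /embedding_of_contains_induced[f [f_inj f_mono]].
(* Translation preserves symmetric differences, so [D] keeps all adjacencies and places the added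
   vertex at [set0]. *)
pose D u := symdiff (val (f None)) (val (f u)).
have D_inj : injective D by move=> u v /symdiff_inj/val_inj/f_inj.
have adjD (u v : tgraph M) : (#|symdiff (D u) (D v)| == 2) = adj u v.
  by rewrite symdiff_translate -f_mono.
have cardD u : (#|D u| == 2) = adj (None : tgraph M) u by rewrite -f_mono.
have D_None : D None = set0 by apply/setP => x; rewrite in_symdiff addbb inE.
pose a : 'I_M := Ordinal (ltnW M_gt1); pose b : 'I_M := Ordinal M_gt1.
pose A := D (Some a); pose B := D (Some b).
have cA : #|A| = 2 by apply/eqP; rewrite cardD.
have cB : #|B| = 2 by apply/eqP; rewrite cardD.
have cAB : #|symdiff A B| = 2 by apply/eqP; rewrite adjD.
pose I := ~: [set a; b].
have sub : [set D (Some i) | i in I] \subset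
           [set d |: (A :|: B) | d in ~: (A :|: B)].
  apply/subsetP => _ /imsetP[i + ->]; rewrite !inE negb_or => /andP[ia ib].
  have [||||d d_notin ->] := quadruple_of_two_pairs (D := D (Some i)) cA cB cAB.
  - by apply/eqP; rewrite adjD.
  - by apply/eqP; rewrite adjD.
  - by rewrite -D_None (inj_eq D_inj).
  - by rewrite cardD /=; move: ia ib; rewrite -!val_eqE /=; lia.
  by apply/imsetP; exists d; rewrite // inE.
(* [#|A :&: B| = 1], so the right-hand family has at most [M - 3] members, against [M - 2] on the
   left. *)
have := leq_trans (subset_leq_card sub) (leq_imset_card _ _).
rewrite card_imset => [|i j /D_inj[]//].
have := cardsC [set a; b]; have := cardsC (A :|: B); have := cardsUI A B.
have := card_symdiff A B; rewrite card_ord cards2 /= cA cB cAB -/I.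
lia.
Qed.

Lemma del_edge_halved_cube_tgraph M (e : {set halved_cube M}) :
    2 < M -> e \in edges (halved_cube M) ->
  contains_induced (del_edge e) (tgraph M).
Proof.
move=> M_gt2 /imset2P[X Y _ + ->]; rewrite inE halved_cube_adjE => /andP[_ XY].
have /cards2P[a [b [ab XYab]]] := XY.
have [c] : exists c, c \in ~: [set a; b].
  apply/set0Pn; rewrite -card_gt0.
  by have := cardsC [set a; b]; rewrite card_ord cards2; lia.
rewrite inE => c_notin.
pose T := symdiff [set a; b] [set c].
have cT : #|T| = 3 by rewrite card_symdiff1 (negPf c_notin) cards2 ab.
(* [W] is odd, so each set at distance 1 from it is a vertex; these are the [M] clique vertices
   [k i]. *)
pose W := symdiff (val X) T.
have W_odd : odd #|W| by rewrite odd_symdiff cT (negPf (valP X)).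
have evW i : ~~ odd #|symdiff W [set i]| by rewrite odd_symdiff W_odd cards1.
pose i0 : 'I_M := Ordinal (ltnW (ltnW M_gt2)).
pose i1 : 'I_M := Ordinal (ltnW M_gt2).
have [s [s0 s1]] := perm_exists2 (isT : i0 != i1) ab.
pose k i : halved_cube M := exist _ (symdiff W [set i]) (evW i).
have k_inj : injective k by move=> i j [] /symdiff_inj/set1_inj.
have Yk : Y = k c.
  apply: val_inj => /=; rewrite /W /T -XYab !symdiffA.
  by apply/setP => x; rewrite !in_symdiff addbb addFb addbK.
(* This set has 2 elements for [i] in [T] and 4 otherwise, so [X] is outside the clique and sees
   [k a], [k b] and [k c = Y]. *)
have Xk i : symdiff (val X) (val (k i)) = symdiff T [set i].
  by rewrite /= -symdiffA symdiffK.
have X_neq i : X != k i.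
  apply/eqP => Xki; have := card_symdiff1 T i; rewrite -Xk -Xki.
  by rewrite /symdiff setDv setU0 cards0 cT; case: ifP.
have adj_Xk i : adj (X : del_edge [set X; Y]) (k i) = (i \in [set a; b]).
  rewrite /= /del_edge_adj halved_cube_adjE Xk card_symdiff1 cT.
  rewrite Yk (inj_eq (@set2_injr _ X)) (inj_eq k_inj) in_symdiff in_set1.
  case: (eqVneq i c) => [->|_]; first by rewrite (negPf c_notin).
  by case: (i \in [set a; b]).
have adj_kk i j : adj (k i : del_edge [set X; Y]) (k j) = (i != j).
  rewrite /= /del_edge_adj halved_cube_adjE symdiff_translate card_symdiff1.
  rewrite cards1 in_set1 (eq_sym j).
  (* The deleted edge has the endpoint [X], so no clique edge is lost. *)
  have -> : [set k i; k j] != [set X; Y].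
    by apply/eqP => /setP/(_ X); rewrite !inE eqxx !(negPf (X_neq _)).
  by case: (i == j).
(* The relabelling [s] sends the indices 0 and 1, fixed in [tgraph] as the neighbours of [None], to
   [a] and [b]. *)
have s_lt2 i : (s i \in [set a; b]) = (i < 2).
  rewrite -s0 -s1 !inE !(inj_eq perm_inj) -!val_eqE /=; lia.
pose f (u : tgraph M) : del_edge [set X; Y] := if u is Some i then k (s i) else X.
apply: (@contains_induced_embedding _ _ f).
  move=> [i|] [j|] //=.
  - by move=> /k_inj/perm_inj->.
  - by move=> /esym/eqP; rewrite (negPf (X_neq _)).
  - by move=> /eqP; rewrite (negPf (X_neq _)).
move=> [i|] [j|]; rewrite /f.
- by rewrite adj_kk (inj_eq perm_inj).
- by rewrite adj_sym adj_Xk s_lt2.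
- by rewrite adj_Xk s_lt2.
- by rewrite adj_irrefl.
Qed.

Theorem proposition6p1 (M : nat) (hM : 4 <= M) :
  deletion_host (halved_cube M) (tgraph M).
Proof.
split.
- by apply: halved_cube_edges_neq0; apply: leq_trans hM.
- by apply: halved_cube_tgraph_free; apply: leq_trans hM.
- by move=> e; apply: del_edge_halved_cube_tgraph; apply: leq_trans hM.
Qed.
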